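(* Let $n\ge 2$. For all $\mathbf{p}=(p_1,\ldots,p_n)\in[0,1]^n$ with $\mathbf{p}\ne \mathbf{0}$, $$\frac{\overline{P}_u(n,1,\mathbf{p})}{\overline{P}(n,1,\mathbf{p})}\le\frac{4}{3}.$$ Moreover, the ratio equals $4/3$ when $\sum_{i=1}^{n-1}p_i=1/2$ and $p_n=1/2$.
   Context: Write $[n]=\{1,\ldots,n\}$ and $K_n=\{(i,j): 1\le i<j\le n\}$. Let $\Theta(\{0,1\}^n)$ be the set of all probability distributions on $\{0,1\}^n$; for $\theta$ in this set, $\tilde{\mathbf{c}}=(\tilde c_1,\ldots,\tilde c_n)$ denotes a random vector with law $\theta$. For $\mathbf{p}\in[0,1]^n$ let $\Theta(\mathbf{p})=\{\theta\in\Theta(\{0,1\}^n):\mathbb{P}_\theta(\tilde c_i=1)=p_i\ \forall i\in[n]\}$ and let $$\Theta(\mathbf{p},p_ip_j;(i,j)\in K_n)=\{\theta\in\Theta(\mathbf{p}): \mathbb{P}_\theta(\tilde c_i=1,\tilde c_j=1)=p_ip_j\ \forall (i,j)\in K_n\}$$ (pairwise independence). Then $$\overline{P}_u(n,1,\mathbf{p})=\max_{\theta\in\Theta(\mathbf{p})}\mathbb{P}_\theta\left(\sum_{i\in[n]}\tilde c_i\ge 1\right),\qquad \overline{P}(n,1,\mathbf{p})=\max_{\theta\in\Theta(\mathbf{p},p_ip_j;(i,j)\in K_n)}\mathbb{P}_\theta\left(\sum_{i\in[n]}\tilde c_i\ge 1\right).$$ The former is the Boole union bound, known to equal $\min\left(\sum_{i\in[n]}p_i,1\right)$.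 *)

(* Defs.v *)
From mathcomp Require Import all_boot all_order all_algebra.
From mathcomp Require Import all_classical all_reals all_analysis.
Set Implicit Arguments.
Unset Strict Implicit.
Unset Printing Implicit Defensive.
Import Order.TTheory GRing.Theory Num.Theory.
Import numFieldNormedType.Exports.
Import ArrowAsProduct.
Local Open Scope classical_set_scope.
Local Open Scope ring_scope.

Section Bounds.
Variables (R : realType) (n : nat).

Definition outcome := {ffun 'I_n -> bool}.

(* Probability distributions on {0,1}^n, as probability mass functions. *)
Definition Theta_cube : set (outcome -> R) :=
  [set theta | (forall c, 0 <= theta c) /\ \sum_c theta c = 1].

Definition Prob (theta : outcome -> R) (A : pred outcome) : R :=
  \sum_(c | A c) theta c.

Definition Theta (p : {ffun 'I_n -> R}) : set (outcome -> R) :=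
  [set theta | Theta_cube theta /\
     forall i, Prob theta (fun c => c i) = p i].

Definition Theta_pairwise (p : {ffun 'I_n -> R}) : set (outcome -> R) :=
  [set theta | Theta p theta /\
     forall i j : 'I_n, (i < j)%N ->
       Prob theta (fun c => c i && c j) = p i * p j].

(* The event that the sum of the coordinates is at least k. *)
Definition sum_ge (k : nat) : pred outcome :=
  fun c => (k <= \sum_(i < n) c i)%N.

(* For p in [0,1]^n both suprema are maxima: see [Pu_bar_max], [P_bar_max]. *)
Definition Pu_bar (k : nat) (p : {ffun 'I_n -> R}) : R :=
  sup [set Prob theta (sum_ge k) | theta in Theta p].

Definition P_bar (k : nat) (p : {ffun 'I_n -> R}) : R :=
  sup [set Prob theta (sum_ge k) | theta in Theta_pairwise p].

Lemma Prob_continuous (A : pred outcome) :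
  continuous (fun theta : outcome -> R => Prob theta A).
Proof.
move=> t.
apply: (@cvg_big R outcome +%R 0 A (@add_continuous R) _ (nbhs t)
  (index_enum _) (fun c theta => theta c)) => c _.
exact: (@proj_continuous outcome (fun=> R) c t).
Qed.

Lemma closed_Prob_eq (A : pred outcome) (a : R) :
  closed [set theta : outcome -> R | Prob theta A = a].
Proof.
apply: (@preimage_closed _ _ (fun theta => Prob theta A) [set a]).
  by move=> t _; exact: Prob_continuous.
exact: closed_eq.
Qed.

Lemma Theta_cube_compact : compact Theta_cube.
Proof.
have K : compact [set t : outcome -> R | forall c, `[0, 1]%classic (t c)].
  apply: (@tychonoff outcome (fun=> R) (fun=> `[0, 1]%classic)) => _.
  exact: segment_compact.
suff -> : Theta_cube = [set t : outcome -> R | forall c, `[0, 1]%classic (t c)]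
     `&` [set t | Prob t predT = 1].
  by apply: compact_closedI K _; exact: closed_Prob_eq.
apply/seteqP; split=> t /= [t0 t1]; split=> // c; last first.
  by have := t0 c; rewrite in_itv /= => /andP[].
rewrite in_itv /= t0 -t1 (bigD1 c) //= lerDl.
exact: sumr_ge0.
Qed.

Lemma Theta_compact p : compact (Theta p).
Proof.
suff -> : Theta p = Theta_cube `&`
    \bigcap_i [set t | Prob t (fun c => c i) = p i].
  apply: compact_closedI Theta_cube_compact _.
  by apply: closed_bigI => i _; exact: closed_Prob_eq.
apply/seteqP; split=> t /= [t0 t1]; split=> // i; first by move=> _; exact: t1.
exact: (t1 i I).
Qed.

Lemma Theta_pairwise_compact p : compact (Theta_pairwise p).
Proof.
suff -> : Theta_pairwise p = Theta p `&`
    \bigcap_(ij in [set ij : 'I_n * 'I_n | (ij.1 < ij.2)%N])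
      [set t | Prob t (fun c => c ij.1 && c ij.2) = p ij.1 * p ij.2].
  apply: compact_closedI (@Theta_compact p) _.
  by apply: closed_bigI => i _; exact: closed_Prob_eq.
apply/seteqP; split=> t /= [t0 t1]; split=> //.
  by move=> [i j] /= ij; exact: t1.
by move=> i j ij; exact: (t1 (i, j) ij).
Qed.

Definition product_pmf (p : {ffun 'I_n -> R}) (c : outcome) : R :=
  \prod_i (if c i then p i else 1 - p i).

Lemma product_pmfE (p : {ffun 'I_n -> R}) (I : pred 'I_n) :
  Prob (product_pmf p) (fun c => [forall i, I i ==> c i]) =
    \prod_(i | I i) p i.
Proof.
pose F i b : R := if b then p i else 1 - p i.
pose Q i : pred bool := fun b => I i ==> b.
transitivity (\sum_(c in family Q) \prod_i F i (c i)).
  by apply: eq_bigl => c; apply/forallP/familyP.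
rewrite -bigA_distr_big_dep [RHS]big_mkcond /=; apply: eq_bigr => i _.
rewrite big_mkcond big_bool /= /Q /= implybT.
by case: (I i); rewrite /F /= ?addr0 // addrC subrK.
Qed.

Lemma product_pmf_pairwise (p : {ffun 'I_n -> R}) :
  (forall i, 0 <= p i <= 1) -> Theta_pairwise p (product_pmf p).
Proof.
move=> p01; split; first split; first split.
- move=> c; apply: prodr_ge0 => i _; have /andP[p0 p1] := p01 i.
  by case: ifP; rewrite ?subr_ge0.
- transitivity (Prob (product_pmf p) (fun c => [forall i, pred0 i ==> c i])).
    by apply: eq_bigl => c; symmetry; apply/forallP.
  by rewrite product_pmfE big_pred0.
- move=> i; transitivity (\prod_(k | pred1 i k) p k); last exact: big_pred1_eq.
  rewrite -product_pmfE; apply: eq_bigl => c.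
  apply/idP/forallP => [ci k|/(_ i)]; last first.
    by rewrite /= eqxx.
  by apply/implyP => /eqP ->.
- move=> i j ij; transitivity (\prod_(k | pred2 i j k) p k).
    rewrite -product_pmfE; apply: eq_bigl => c.
    apply/andP/forallP => [[ci cj] k|H].
      by apply/implyP => /orP[] /eqP ->.
    by split; [have := H i|have := H j]; rewrite /= eqxx ?orbT.
  have ji : j != i by rewrite -val_eqE /= neq_ltn ij orbT.
  rewrite (bigD1 i) /= ?eqxx // (big_pred1 j) // => k /=.
  by case: (eqVneq k j) => [->|]; rewrite ?ji ?andbT ?orbT ?orbF ?andbN.
Qed.

Lemma sup_Prob_max (T : set (outcome -> R)) (A : pred outcome) :
  compact T -> T !=set0 ->
  exists2 theta, T theta &
    sup [set Prob t A | t in T] = Prob theta A /\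
    forall t, T t -> Prob t A <= Prob theta A.
Proof.
move=> cT T0.
have [|m Tm mP] := compact_EVT_max (f := fun t => Prob t A) T0 cT.
  exact/continuous_subspaceT/Prob_continuous.
have {}Tm : T m by move: Tm; rewrite inE.
have {}mP t : T t -> Prob t A <= Prob m A by move=> Tt; apply: mP; rewrite inE.
exists m => //; split=> //; apply/eqP; rewrite eq_le; apply/andP; split.
  by apply: ge_sup => [|_ [t Tt <-]]; [exists (Prob m A); exists m|exact: mP].
apply: ub_le_sup; last by exists m.
by exists (Prob m A) => _ [t Tt <-]; exact: mP.
Qed.

Lemma Pu_bar_max k (p : {ffun 'I_n -> R}) : (forall i, 0 <= p i <= 1) ->
  exists2 theta, Theta p theta &
    Pu_bar k p = Prob theta (sum_ge k) /\
    forall t, Theta p t -> Prob t (sum_ge k) <= Prob theta (sum_ge k).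
Proof.
move=> p01; apply: sup_Prob_max; first exact: Theta_compact.
by exists (product_pmf p); case: (product_pmf_pairwise p01).
Qed.

Lemma P_bar_max k (p : {ffun 'I_n -> R}) : (forall i, 0 <= p i <= 1) ->
  exists2 theta, Theta_pairwise p theta &
    P_bar k p = Prob theta (sum_ge k) /\
    forall t, Theta_pairwise p t -> Prob t (sum_ge k) <= Prob theta (sum_ge k).
Proof.
move=> p01; apply: sup_Prob_max; first exact: Theta_pairwise_compact.
by exists (product_pmf p); exact: product_pmf_pairwise.
Qed.

(* The denominator of the ratio [Pu_bar 1 p / P_bar 1 p] is nonzero. *)
Lemma P_bar_gt0 (p : {ffun 'I_n -> R}) : (forall i, 0 <= p i <= 1) ->
  p != 0 -> 0 < P_bar 1 p.
Proof.
move=> p01 p0; have [t [[[t0 _] tp] _] [-> _]] := P_bar_max 1 p01.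
have [i pi0] : exists i, p i != 0.
  apply/existsP; apply: contraNT p0 => /existsPn H.
  by apply/eqP/ffunP => i; rewrite ffunE; apply/eqP/negbNE/H.
have pi : 0 < p i by rewrite lt_neqAle eq_sym pi0; case/andP: (p01 i).
apply: (lt_le_trans pi); rewrite -tp /Prob [leLHS]big_mkcond [leRHS]big_mkcond.
apply: ler_sum => c _; case: ifP => ci; last by case: ifP.
by rewrite /sum_ge (bigD1 i) //= ci.
Qed.

End Bounds.

(* Main.v *)
Require Import Defs.
From mathcomp Require Import all_boot all_order all_algebra.
From mathcomp Require Import all_classical all_reals all_analysis.
From mathcomp Require Import ring lra.
Import Order.TTheory GRing.Theory Num.Theory.
Local Open Scope ring_scope.

(** The Boole bound is at most [min(S, 1)] with [S] the sum of the [p i], so it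
    suffices to find a pairwise independent law under which the union has
    probability at least [3/4 * min(S, 1)].

    Let [m] be an index with [p m] maximal, hence positive, and let [a] be the
    sum of the other [p i].  If [a <= 1], a pairwise independent law is obtained
    as a mixture of product laws ([P_bar_ge_mixture]): with weight [(p m)^2] the
    coordinates are independent with parameters [p i / p m] (at most 1, and equal
    to 1 at [m]); with weight [(1 - p m) * p i], for each [i], only coordinate [i]
    is 1; with the remaining weight, [(1 - p m) * (1 - a)], all coordinates are 0.
    Only the first component contributes to the bivariate moments, which are
    therefore [p i * p j].  The union then has probability
    [1 - (1 - p m) * (1 - a)] ([P_bar_ge_star]).  This is at least
    [3/4 * min(S, 1)]: since [x * y <= (x + y) / 4] for nonnegative [x], [y] with
    [x + y <= 1], one takes [x, y] to be [p m, a] if [S <= 1] and their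
    complements to 1 otherwise.  If [a > 1], the [p i] with [i != m] are first
    divided by [a]; this is harmless because [P_bar 1] is nondecreasing in [p]
    ([P_bar_monotone]).

    For the equality case, the law carried by the unit vectors shows that the
    Boole bound is 1, while the inequality of Hunter and Worsley for the star
    centred at [m] ([P_bar_le_star]) bounds the other maximum by [3/4]. *)

(** * Probabilities as expectations *)

Section Expectation.
Context {R : realType} {n : nat}.
Implicit Types (t : outcome n -> R) (A : pred (outcome n)).
Implicit Types (p q : {ffun 'I_n -> R}).

Lemma ProbE t A : Prob t A = \sum_c t c * (A c)%:R.
Proof.
by rewrite /Prob big_mkcond; apply: eq_bigr => c _; case: (A c);
  rewrite ?mulr1 ?mulr0.
Qed.

Lemma sum_ge1E (c : outcome n) : sum_ge 1 c = [exists i, c i].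
Proof.
rewrite /sum_ge lt0n sum_nat_eq0; apply/forallPn/existsP => -[i].
  by case ci: (c i) => //; exists i.
by move=> ci; exists i; rewrite ci.
Qed.

Lemma Theta_pairwise_neq p t i j : Theta_pairwise p t -> i != j ->
  Prob t (fun c => c i && c j) = p i * p j.
Proof.
move=> [_ tp]; rewrite -val_eqE neq_ltn => /orP[] ij; first exact: tp.
by rewrite mulrC -tp //; apply: eq_bigl => c; rewrite andbC.
Qed.

Lemma P_bar_ge {p t} : (forall i, 0 <= p i <= 1) -> Theta_pairwise p t ->
  Prob t (sum_ge 1) <= P_bar 1 p.
Proof. by move=> p01; have [s _ [-> H]] := P_bar_max 1 p01; exact: H. Qed.

Lemma Pu_bar_ge {p t} : (forall i, 0 <= p i <= 1) -> Theta p t ->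
  Prob t (sum_ge 1) <= Pu_bar 1 p.
Proof. by move=> p01; have [s _ [-> H]] := Pu_bar_max 1 p01; exact: H. Qed.

(** * Upper bounds *)

Lemma Pu_bar_le1 p : (forall i, 0 <= p i <= 1) -> Pu_bar 1 p <= 1.
Proof.
move=> p01; have [t [[t0 t1] _] [-> _]] := Pu_bar_max 1 p01.
rewrite ProbE -[leRHS]t1; apply: ler_sum => c _.
by rewrite ler_piMr // lern1 leq_b1.
Qed.

Lemma Pu_bar_le_sum p : (forall i, 0 <= p i <= 1) ->
  Pu_bar 1 p <= \sum_i p i.
Proof.
move=> p01; have [t [[t0 _] tp] [-> _]] := Pu_bar_max 1 p01.
under [leRHS]eq_bigr do rewrite -tp ProbE.
rewrite exchange_big ProbE; apply: ler_sum => c _; rewrite -mulr_sumr.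
apply: ler_wpM2l => //; rewrite sum_ge1E; case: existsP => [[i ci]|_].
  by rewrite (bigD1 i) //= ci lerDl sumr_ge0.
by rewrite sumr_ge0.
Qed.

(** The Hunter-Worsley bound for the star centred at [m]. *)
Lemma P_bar_le_star p m : (forall i, 0 <= p i <= 1) ->
  P_bar 1 p <= \sum_i p i - p m * \sum_(i | i != m) p i.
Proof.
move=> p01; have [t tP [-> _]] := P_bar_max 1 p01.
have [[[t0 _] tp] _] := tP.
under [X in X - _]eq_bigr do rewrite -tp ProbE.
rewrite mulr_sumr.
under [X in _ - X]eq_bigr => i im do
  rewrite mulrC -(Theta_pairwise_neq _ _ _ _ tP im) ProbE.
rewrite exchange_big [X in _ - X]exchange_big -sumrB ProbE.
apply: ler_sum => c _; rewrite -!mulr_sumr -mulrBr.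
apply: ler_wpM2l => //; rewrite (bigD1 m) //= -addrA -sumrB sum_ge1E.
case cm: (c m).
  by rewrite big1 ?addr0 ?lern1 ?leq_b1 // => i _; rewrite andbT subrr.
rewrite add0r; case: existsP => [[i ci]|_]; last first.
  by rewrite sumr_ge0 // => i _; rewrite andbF subr0.
have im : i != m by apply: contraFneq cm => <-.
rewrite (bigD1 i) //= ci andbF subr0 lerDl sumr_ge0 // => j _.
by rewrite andbF subr0.
Qed.

(** * Mixtures of product laws *)

Lemma Prob_union_product p :
  (forall i, 0 <= p i <= 1) ->
  Prob (product_pmf p) (sum_ge 1) = 1 - \prod_i (1 - p i).
Proof.
move=> p01; have [[[_ t1] _] _] := product_pmf_pairwise p01.
rewrite -[X in _ = X - _]t1 (bigID (sum_ge 1)) /=.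
rewrite [X in _ + X - _](big_pred1 [ffun=> false]).
  rewrite [X in _ + X - _](_ : _ = \prod_i (1 - p i)) ?addrK //.
  by apply: eq_bigr => i _; rewrite ffunE.
move=> c; rewrite sum_ge1E negb_exists; apply/forallP/eqP => [c0|-> i].
  by apply/ffunP => i; rewrite ffunE; apply/negbTE/c0.
by rewrite ffunE.
Qed.

(** A finite mixture, with weights [w k], of product laws with parameters [r k]
    is a pairwise independent law with marginals [p] as soon as the averages of
    [r k i] and of [r k i * r k j] are [p i] and [p i * p j].  The left-hand side
    is the probability of the union under this mixture. *)
Lemma P_bar_ge_mixture {K : finType}
    (w : K -> R) (r : K -> {ffun 'I_n -> R}) p :
  (forall i, 0 <= p i <= 1) ->
  (forall k, 0 <= w k) -> \sum_k w k = 1 ->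
  (forall k i, 0 <= r k i <= 1) ->
  (forall i, \sum_k w k * r k i = p i) ->
  (forall i j, i != j -> \sum_k w k * (r k i * r k j) = p i * p j) ->
  1 - \sum_k w k * \prod_i (1 - r k i) <= P_bar 1 p.
Proof.
move=> p01 w0 w1 r01 rp rpp.
pose t c := \sum_k w k * product_pmf (r k) c.
have tE A : Prob t A = \sum_k w k * Prob (product_pmf (r k)) A.
  by rewrite /Prob exchange_big; under eq_bigr do rewrite -mulr_sumr.
have rP k := product_pmf_pairwise (r01 k).
have tP : Theta_pairwise p t.
  split; first split; first split.
  - move=> c; apply: sumr_ge0 => k _; apply: mulr_ge0 => //.
    by have [[[]]] := rP k.
  - rewrite -[LHS]/(Prob t predT) tE -[RHS]w1; apply: eq_bigr => k _.
    by have [[[_ E] _] _] := rP k; rewrite [Prob _ _]E mulr1.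
  - move=> i; rewrite tE -rp; apply: eq_bigr => k _.
    by have [[_ ->] _] := rP k.
  - move=> i j ij; rewrite tE -rpp; last by rewrite -val_eqE neq_ltn ij.
    by apply: eq_bigr => k _; have [_ ->] := rP k.
apply: le_trans (P_bar_ge p01 tP); rewrite tE -[X in X - _]w1 -sumrB.
apply: ler_sum => k _.
by rewrite Prob_union_product // mulrBr mulr1.
Qed.

(** A pairwise independent vector with smaller marginals remains pairwise
    independent, and becomes larger, when each coordinate is replaced by its
    disjunction with an independent Bernoulli variable; its parameter [b i] is
    chosen so that the new marginal [b i + (1 - b i) * q i] is [p i].  The new
    law is the mixture, over the outcomes [c] of the old one, of product laws
    with parameters 1 where [c i] holds and [b i] elsewhere. *)
Lemma P_bar_monotone q p : (forall i, 0 <= q i) -> (forall i, q i <= p i) ->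
  (forall i, p i <= 1) -> P_bar 1 q <= P_bar 1 p.
Proof.
move=> q0 qp p1.
have p01 i : 0 <= p i <= 1 by rewrite p1 (le_trans (q0 i)).
have q01 i : 0 <= q i <= 1 by rewrite q0 (le_trans (qp i)).
have [t tP [-> _]] := P_bar_max 1 q01.
have [[[t0 t1] tq] _] := tP.
(* If [q i = 1] the quotient is 0, as it should be since then [p i = 1]. *)
pose b i := (p i - q i) / (1 - q i).
have b01 i : 0 <= b i <= 1.
  have [q1|q1] := eqVneq (q i) 1.
    by rewrite /b q1 subrr invr0 mulr0 lexx ler01.
  have q1' : 0 < 1 - q i by rewrite subr_gt0 lt_neqAle q1; case/andP: (q01 i).
  rewrite divr_ge0 ?subr_ge0 ?qp ?(le_trans (qp i)) //=.
  by rewrite ler_pdivrMr // mul1r lerB.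
have bE i : b i + (1 - b i) * q i = p i.
  have [q1|q1] := eqVneq (q i) 1.
    by have := qp i; have := p1 i; rewrite q1; lra.
  by rewrite /b; field; rewrite subr_eq0 eq_sym.
pose r (c : outcome n) : {ffun 'I_n -> R} :=
  [ffun i => b i + (1 - b i) * (c i)%:R].
have tc i : \sum_c t c * (c i)%:R = q i by rewrite -tq ProbE.
have E i j : i != j -> \sum_c t c * ((c i)%:R * (c j)%:R) = q i * q j.
  move=> ij; rewrite -(Theta_pairwise_neq _ _ _ _ tP ij) ProbE.
  by apply: eq_bigr => c _; rewrite -natrM mulnb.
apply: le_trans (P_bar_ge_mixture t r p p01 t0 t1 _ _ _).
- rewrite ProbE -[X in X - _]t1 -sumrB; apply: ler_sum => c _.
  rewrite -{2}[t c]mulr1 -mulrBr; apply: ler_wpM2l => //.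
  rewrite sum_ge1E; case: existsP => [[i ci]|_].
    by rewrite (bigD1 i) //= ffunE ci mulr1 subrKC subrr mul0r subr0.
  rewrite subr_ge0; apply: Num.Theory.prodr_ile1 => i _.
  rewrite ffunE; have := b01 i.
  by case: (c i) => /=; lra.
- move=> c i; rewrite ffunE; have := b01 i.
  by case: (c i) => /=; lra.
- move=> i; transitivity (b i * \sum_c t c + (1 - b i) * \sum_c t c * (c i)%:R).
    rewrite !mulr_sumr -big_split; apply: eq_bigr => c _.
    by rewrite /= ffunE; ring.
  by rewrite t1 tc mulr1.
- move=> i j ij; transitivity (b i * b j * \sum_c t c
    + b i * (1 - b j) * \sum_c t c * (c j)%:R
    + b j * (1 - b i) * \sum_c t c * (c i)%:R
    + (1 - b i) * (1 - b j) * \sum_c t c * ((c i)%:R * (c j)%:R)).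
    rewrite !mulr_sumr -!big_split; apply: eq_bigr => c _.
    by rewrite /= !ffunE; ring.
  by rewrite t1 !tc E // -(bE i) -(bE j); ring.
Qed.

(** * The extremal construction *)

Lemma sum_option {T : finType} (F : option T -> R) :
  \sum_k F k = F None + \sum_i F (Some i).
Proof.
rewrite (bigD1 None) //=; congr (_ + _).
rewrite (reindex_omap Some id) => [|[]//].
by apply: eq_bigl => i; rewrite /= eqxx.
Qed.

(** When the [p i] with [i != m] are at most [p m] and have sum [a <= 1], the
    bound of [P_bar_le_star] is attained; the left-hand side is that bound,
    [p m + a - p m * a], in another form. *)
Lemma P_bar_ge_star p m : (forall i, 0 <= p i <= 1) ->
  (forall i, p i <= p m) -> \sum_(i | i != m) p i <= 1 ->
  1 - (1 - p m) * (1 - \sum_(i | i != m) p i) <= P_bar 1 p.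
Proof.
set a := \sum_(i | _) _ => p01 pm a1.
have /andP[pm0 pm1] := p01 m.
have [pm_eq0|pm_neq0] := eqVneq (p m) 0.
  have p0 i : p i = 0.
    by apply/eqP; rewrite eq_le -{1}pm_eq0 pm; case/andP: (p01 i).
  rewrite /a big1 // pm_eq0 !subr0 mulr1 subrr.
  have [t [[[t0 _] _] _] [-> _]] := P_bar_max 1 p01.
  exact: sumr_ge0.
(* [None]: all coordinates zero; [Some None]: independent coordinates;
   [Some (Some i)]: only coordinate [i] is 1. *)
pose w (k : option (option 'I_n)) : R := match k with
  | None => (1 - p m) * (1 - a)
  | Some None => p m ^+ 2
  | Some (Some i) => (1 - p m) * p i
  end.
pose r (k : option (option 'I_n)) : {ffun 'I_n -> R} := [ffun j => match k with
  | None => 0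
  | Some None => p j / p m
  | Some (Some i) => (i == j)%:R
  end].
have sumK (F : option (option 'I_n) -> R) :
    \sum_k F k = F None + (F (Some None) + \sum_i F (Some (Some i))).
  by rewrite !sum_option.
have prod0 k : k != None -> \prod_i (1 - r k i) = 0.
  case: k => [[i|]|] // _.
    by rewrite (bigD1 i) //= ffunE eqxx subrr mul0r.
  by rewrite (bigD1 m) //= ffunE divff // subrr mul0r.
apply: le_trans (P_bar_ge_mixture w r p p01 _ _ _ _ _).
- rewrite lerB // sumK (prod0 (Some None)) // mulr0 add0r.
  rewrite [X in _ + X]big1 => [|i _]; last by rewrite prod0 // mulr0.
  by rewrite addr0 big1 ?mulr1 // => i _; rewrite ffunE subr0.
- case=> [[i|]|] /=; rewrite ?sqr_ge0 // mulr_ge0 ?subr_ge0 //.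
  by case/andP: (p01 i).
- rewrite sumK /= -mulr_sumr (bigD1 m) //= -/a; ring.
- case=> [[i|]|] j; rewrite ffunE ?ler0n ?lern1 ?leq_b1 ?lexx ?ler01 //.
  have pm_gt0 : 0 < p m by rewrite lt_neqAle eq_sym pm_neq0.
  have /andP[pj0 _] := p01 j.
  by rewrite divr_ge0 // ler_pdivrMr // mul1r pm.
- move=> j; rewrite sumK (bigD1 j) //= big1 => [|i ij].
    by rewrite !ffunE eqxx /=; field.
  by rewrite !ffunE (negbTE ij) mulr0.
- move=> i j ij; rewrite sumK big1 => [|k _].
    by rewrite !ffunE /=; field.
  rewrite !ffunE; have [->|_] := eqVneq k i; last by rewrite mul0r mulr0.
  by rewrite (negbTE ij) !mulr0.
Qed.

Lemma mulr_le_quarter_add {x y : R} : 0 <= x -> 0 <= y -> x + y <= 1 ->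
  x * y <= (x + y) / 4.
Proof.
move=> x0 y0 xy1.
have : (x + y) * (x + y) <= x + y by rewrite ler_piMr // addr_ge0.
have : 0 <= (x - y) * (x - y) by rewrite -expr2 sqr_ge0.
nra.
Qed.

Lemma P_bar_ge_three_quarters p : (0 < n)%N -> (forall i, 0 <= p i <= 1) ->
  3 / 4 * Num.min (\sum_i p i) 1 <= P_bar 1 p.
Proof.
move=> n_gt0 p01.
have [m pm] : exists m, forall i, p i <= p m.
  case: (@arg_maxP _ _ _ (Ordinal n_gt0) xpredT p isT) => m _ H.
  by exists m => i; exact: H.
have /andP[pm0 pm1] := p01 m.
rewrite (bigD1 m) //=; set a := \sum_(i | _) _.
have a0 : 0 <= a by apply: sumr_ge0 => i _; case/andP: (p01 i).
have [a1|a1] := leP a 1.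
  apply: le_trans (P_bar_ge_star p m p01 pm a1); rewrite -/a.
  have [Sle|Sgt] := leP (p m + a) 1.
    by have := mulr_le_quarter_add pm0 a0 Sle; lra.
  have um : 0 <= 1 - p m by rewrite subr_ge0.
  have ua : 0 <= 1 - a by rewrite subr_ge0.
  by have := mulr_le_quarter_add um ua; lra.
pose q : {ffun 'I_n -> R} := [ffun i => if i == m then p m else p i / a].
have a_gt0 : 0 < a by apply: lt_trans a1.
have qp i : q i <= p i.
  rewrite ffunE; case: eqP => [->//|_].
  rewrite ler_pdivrMr // ler_peMr ?(ltW a1) //.
  by case/andP: (p01 i).
have q0 i : 0 <= q i.
  have /andP[? _] := p01 i.
  by rewrite ffunE; case: eqP => // _; rewrite divr_ge0.
have p1 i : p i <= 1 by case/andP: (p01 i).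
have q01 i : 0 <= q i <= 1 by rewrite q0 (le_trans (qp i)).
have qm : q m = p m by rewrite ffunE eqxx.
have qa : \sum_(i | i != m) q i = 1.
  under eq_bigr => i /negbTE im do rewrite ffunE im.
  by rewrite -mulr_suml divff // gt_eqF.
apply: le_trans (P_bar_monotone q p q0 qp p1).
have qmax i : q i <= q m by rewrite qm (le_trans (qp i)).
apply: le_trans (P_bar_ge_star q m q01 qmax _); rewrite qa // subrr mulr0 subr0.
by case: (leP (p m + a) 1); lra.
Qed.

(** Attained by the law on the unit vectors, with mass [p i] on the [i]-th one. *)
Lemma Pu_bar_ge1 p : (forall i, 0 <= p i <= 1) -> \sum_i p i = 1 ->
  1 <= Pu_bar 1 p.
Proof.
move=> p01 p1.
pose e i : outcome n := [ffun j => i == j].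
pose t c := \sum_i p i * (c == e i)%:R.
have tE A : Prob t A = \sum_i p i * (A (e i))%:R.
  rewrite ProbE; under eq_bigr do rewrite mulr_suml.
  rewrite exchange_big; apply: eq_bigr => i _.
  rewrite (bigD1 (e i)) //= eqxx mulr1 big1 ?addr0 // => c /negbTE ->.
  by rewrite mulr0 mul0r.
have tP : Theta p t.
  split; first split.
  - move=> c; apply: sumr_ge0 => i _; rewrite mulr_ge0 //.
    by case/andP: (p01 i).
  - rewrite -[LHS]/(Prob t predT) tE -[RHS]p1.
    by apply: eq_bigr => i _; rewrite mulr1.
  - move=> i; rewrite tE (bigD1 i) //= ffunE eqxx mulr1 big1 ?addr0 // => j ji.
    by rewrite ffunE (negbTE ji) mulr0.
apply: le_trans (Pu_bar_ge p01 tP); rewrite tE -[leLHS]p1.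
apply: ler_sum => i _; suff -> : sum_ge 1 (e i) by rewrite mulr1.
by rewrite sum_ge1E; apply/existsP; exists i; rewrite ffunE.
Qed.

End Expectation.

(** * The ratio of the two bounds *)

Theorem proposition2p5 (R : realType) (n : nat) (n_ge2 : (2 <= n)%N)
    (p : {ffun 'I_n -> R}) (p01 : forall i, 0 <= p i <= 1) (p_neq0 : p != 0) :
  Pu_bar 1 p / P_bar 1 p <= 4 / 3 /\
  (forall m : 'I_n, m.+1 = n ->
     \sum_(i < n | (i < m)%N) p i = 1 / 2 -> p m = 1 / 2 ->
     Pu_bar 1 p / P_bar 1 p = 4 / 3).
Proof.
have P0 := P_bar_gt0 p01 p_neq0.
have ratio_le : Pu_bar 1 p / P_bar 1 p <= 4 / 3.
  rewrite ler_pdivrMr //.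
  have PuS := Pu_bar_le_sum p p01; have Pu1 := Pu_bar_le1 p p01.
  have := P_bar_ge_three_quarters p (ltnW n_ge2) p01.
  by case: (leP (\sum_i p i) 1); lra.
split=> // m mn Sm pm.
have sum_neq : \sum_(i | i != m) p i = 1 / 2.
  rewrite -Sm; apply: eq_bigl => i.
  by rewrite ltn_neqAle -val_eqE /= -ltnS mn ltn_ord andbT.
have S1 : \sum_i p i = 1 by rewrite (bigD1 m) //= sum_neq pm; field.
apply/eqP; rewrite eq_le ratio_le ler_pdivlMr //=.
have Pu1 := Pu_bar_ge1 p p01 S1.
by have := P_bar_le_star p m p01; rewrite S1 sum_neq pm; lra.
Qed.
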